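(* Let $N=2n\geq4$ be even, $\omega=\exp(2\pi i/N)$, and let $u\in\mathbb{C}$ with $u\neq0$, $u^N\neq1$. With the notation of the context, for $\boldsymbol f=(f_1,\ldots,f_M)\in\mathcal{C}_N^M$ put $$\mathcal{W}_{N,M}(\boldsymbol f;u)=\Lambda f_1(T)\Lambda f_2(T)\cdots f_M(T)\Lambda .$$ Then: (1) For every $M\geq n$ and every $\boldsymbol f\in\mathcal{C}_N^M$, $\mathcal{W}_{N,M}(\boldsymbol f;u)=0$. (2) For $M=n-1$ and $\boldsymbol f=(f_1,\ldots,f_{n-1})\in\mathcal{C}_N^{n-1}$ define $$C_N^+(\boldsymbol f)=\prod_{j=1}^{n-1}\bigl(f_j(\omega^j)-f_j(\omega^{-j})\bigr),\qquad C_N^-(\boldsymbol f)=\prod_{j=1}^{n-1}\bigl(f_j(-\omega^j)-f_j(-\omega^{-j})\bigr).$$ Then $$\operatorname{rank}\mathcal{W}_{N,n-1}(\boldsymbol f;u)=\mathbf 1_{C_N^+(\boldsymbol f)\neq0}+\mathbf 1_{C_N^-(\boldsymbol f)\neq0}.$$ In particular, $\mathcal{W}_{N,n-1}(\boldsymbol f;u)=0$ if and only if $C_N^+(\boldsymbol f)=C_N^-(\boldsymbol f)=0$. (3) The vectors $v_N^+=ax^{n-1}$ and $v_N^-=a\rho x^{n-1}$ of $\mathcal R$ satisfy $$B_{f_1}\cdots B_{f_{n-1}}\,s\,v_N^+=C_N^+(\boldsymbol f)\cdot 1,\qquad B_{f_1}\cdots B_{f_{n-1}}\,s\,v_N^-=C_N^-(\boldsymbol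 f)\,\rho .$$ (4) For every $N\geq6$ there is $\boldsymbol f\in\mathcal{C}_N^{n-1}$ with $\operatorname{rank}\mathcal{W}_{N,n-1}(\boldsymbol f;u)=1$. Consequently, for $N\ge 6$, $J^n$ contains an operator of rank one.
   Context: Index the standard basis of $\mathbb{C}^N$ by $j\in\mathbb{Z}/N\mathbb{Z}$ (writing $\epsilon_j$) and define $t\epsilon_j=\epsilon_{j-1}$, $d\epsilon_j=\omega^j\epsilon_j$. For $u\neq0$, $u^N\neq1$, the operator $a=ud-u^{-1}d^{-1}$ is invertible; put $s=a^{-1}$ and, on $\mathbb{C}^{2N}=\mathbb{C}^N\oplus\mathbb{C}^N$, $$T=\begin{pmatrix}t&0\\0&t^{-1}\end{pmatrix},\qquad \Lambda=\begin{pmatrix}s&s\\-s&-s\end{pmatrix}.$$ Let $A$ be the unital subalgebra of $\operatorname{End}(\mathbb{C}^{2N})$ generated by $T$ and $\Lambda$, and $J=A\Lambda A$. Cyclic model: $\mathcal R=\mathbb{C}[z,z^{-1}]/(z^N-1)$ is identified with $\mathbb{C}^N$ by evaluation $f\mapsto (f(\omega^j))_{j}$. Under this identification $d$ is multiplication by $z$, $(tf)(z)=f(\omega z)$, $a$ is (multiplication by) $uz-u^{-1}z^{-1}$, a unit of $\mathcal R$, and $s$ is multiplication by $a^{-1}$. Put $x=uz+u^{-1}z^{-1}\in\mathcal R$ and $\rho=z^n\in\mathcal R$. $\mathcal{C}_N=\mathbb{C}[X,X^{-1}]/(X^N-1)$. Since $T^N=\mathrm{I}$ and $t^N=\mathrm{I}$,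 the operators $f(T)$, $f(t)$, $f(t^{-1})$ are defined for $f\in\mathcal{C}_N$, and so are the values of $f$ at $N$th roots of unity. For $f\in\mathcal{C}_N$, $B_f=s\bigl(f(t)-f(t^{-1})\bigr)$, an operator on $\mathcal R\cong\mathbb{C}^N$. $\mathbf 1_{P}$ is $1$ if $P$ holds and $0$ otherwise. *)

(* Defs.v *)
From mathcomp Require Import all_boot all_order all_algebra all_field.
From mathcomp Require Import complex.
From mathcomp Require Import all_classical all_reals all_analysis.

Set Implicit Arguments.
Unset Strict Implicit.
Unset Printing Implicit Defensive.

Import Order.TTheory GRing.Theory Num.Theory.

Local Open Scope ring_scope.
Local Open Scope complex_scope.

(* 'Z_N is by definition the ordinal type 'I_(dimZ N), and dimZ N = N as soon  *)
(* as N > 1. Operators on C^N are matrices whose rows and columns are indexed  *)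
(* by 'Z_N, acting on column vectors.                                          *)
Notation dimZ N := (Zp_trunc N).+2.

(* C[X, X^-1]/(X^N - 1), realized as C[X]/(X^N - 1), where the class 'qX of X  *)
(* is already a unit with inverse 'qX ^+ N.-1. An element coerces to its       *)
(* reduced representative in {poly R[i]}, so values at N-th roots of unity and *)
(* at operators of N-th power 1 are values of that polynomial.                 *)
Notation cyc R N := {poly %/ ('X^N - 1 : {poly R[i]})}.

Section CyclicModel.

Variables (R : realType) (N : nat).

Definition omega : R[i] :=
  cos (pi *+ 2 / N%:R) +i* sin (pi *+ 2 / N%:R).

(* t e_j = e_(j-1), the subtraction being that of 'Z_N *)
Definition t_op : 'M[R[i]]_(dimZ N) :=
  \matrix_(i, j) (i == j - 1 :> 'Z_N)%:R.

Definition d_op : 'M[R[i]]_(dimZ N) := diag_mx (\row_(j < dimZ N) omega ^+ j).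

Definition a_op (u : R[i]) : 'M[R[i]]_(dimZ N) :=
  u *: d_op - u^-1 *: d_op^-1.

Definition s_op (u : R[i]) : 'M[R[i]]_(dimZ N) := (a_op u)^-1.

Definition T_op : 'M[R[i]]_(dimZ N + dimZ N) := block_mx t_op 0 0 t_op^-1.

Definition Lambda (u : R[i]) : 'M[R[i]]_(dimZ N + dimZ N) :=
  block_mx (s_op u) (s_op u) (- s_op u) (- s_op u).

(* A is the unital algebra generated by T and Lambda; J = A Lambda A, where    *)
(* the product of subspaces is the span of the products.                       *)
Definition algA (u : R[i]) : {vspace 'M[R[i]]_(dimZ N + dimZ N)} :=
  agenv <<[:: T_op; Lambda u]>>%VS.

Definition idealJ (u : R[i]) : {vspace 'M[R[i]]_(dimZ N + dimZ N)} :=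
  (algA u * <[Lambda u]> * algA u)%VS.

(* f_1, ..., f_M is given by f : 'I_M -> cyc R N, with f_j at index j - 1.     *)
Definition word M (f : 'I_M -> cyc R N) (u : R[i]) :
    'M[R[i]]_(dimZ N + dimZ N) :=
  Lambda u * \prod_(i < M) (horner_mx T_op (f i) * Lambda u).

Definition B_op (u : R[i]) (f : cyc R N) : 'M[R[i]]_(dimZ N) :=
  s_op u * (horner_mx t_op f - horner_mx t_op^-1 f).

Definition Cplus M (f : 'I_M -> cyc R N) : R[i] :=
  \prod_(j < M) ((f j : {poly _}).[omega ^+ j.+1]
                 - (f j : {poly _}).[omega ^- j.+1]).

Definition Cminus M (f : 'I_M -> cyc R N) : R[i] :=
  \prod_(j < M) ((f j : {poly _}).[- omega ^+ j.+1]
                 - (f j : {poly _}).[- omega ^- j.+1]).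

(* Under evalR, d is multiplication by z and t is f(z) |-> f(omega z).         *)
Definition evalR (f : cyc R N) : 'cV[R[i]]_(dimZ N) :=
  \col_(j < dimZ N) (f : {poly _}).[omega ^+ j].

Definition zR : cyc R N := 'qX.

Definition aR (u : R[i]) : cyc R N := u *: zR - u^-1 *: zR^-1.

Definition xR (u : R[i]) : cyc R N := u *: zR + u^-1 *: zR^-1.

Definition rhoR (n : nat) : cyc R N := zR ^+ n.

End CyclicModel.

Arguments omega : clear implicits.
Arguments t_op : clear implicits.
Arguments d_op : clear implicits.
Arguments T_op : clear implicits.
Arguments zR : clear implicits.
Arguments rhoR : clear implicits.
Arguments a_op {R} N u.
Arguments s_op {R} N u.
Arguments Lambda {R} N u.
Arguments algA {R} N u.
Arguments idealJ {R} N u.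
Arguments aR {R} N u.
Arguments xR {R} N u.

(* Main.v *)
(** Write w = u z, so that x = w + w^-1 and a = w - w^-1. The operator
    D_f = f(t) - f(t^-1) multiplies z^k by f(omega^k) - f(omega^-k), an odd
    function of k, so it sends T_k(x) = w^k + w^-k to a multiple of
    w^k - w^-k = a U_(k-1)(x). Hence B_f = s D_f sends polynomials in x of degree
    at most m to polynomials in x of degree at most m - 1, with an explicit
    effect on the top coefficient. The same holds on rho C[x], where omega^k
    is replaced by - omega^k. Since u^N <> 1, the nodes x(omega^j) with j of a
    given parity are pairwise distinct, and Lagrange interpolation shows that R is
    the sum of the polynomials in x of degree < n and rho times these. So n
    factors B_f compose to 0, while n - 1 of them kill everything except the two
    top coefficients, which go to C^+ 1 and C^- rho. Finally Lambda is the
    product of a column, s and a row, and the row and column around f(T)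
    give D_f, so the word has the rank of a product of operators B_f. *)

Require Import Defs.
From mathcomp Require Import all_boot all_order all_algebra all_field.
From mathcomp Require Import complex.
From mathcomp Require Import all_classical all_reals all_analysis.
From mathcomp Require Import ring zify.

Set Implicit Arguments.
Unset Strict Implicit.
Unset Printing Implicit Defensive.

Import Order.TTheory GRing.Theory Num.Theory.

Local Open Scope ring_scope.
Local Open Scope complex_scope.

(** * Polynomials evaluated at matrices *)

Section HornerMatrix.

Variable K : comNzRingType.

Lemma horner_mx_block_diag m n (A : 'M[K]_m.+1) (B : 'M[K]_n.+1) (p : {poly K}) :
  horner_mx (block_mx A 0 0 B : 'M[K]_(m.+1 + n.+1)) p =
  block_mx (horner_mx A p) 0 0 (horner_mx B p).
Proof.
pose D (X : 'M[K]_m.+1) (Y : 'M[K]_n.+1) : 'M[K]_(m.+1 + n.+1) := block_mx X 0 0 Y.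
have DM X Y X' Y' : D X Y * D X' Y' = D (X * X') (Y * Y').
  by apply: etrans (mulmx_block _ _ _ _ _ _ _ _) _; rewrite !(mulmx0, mul0mx, addr0, add0r).
have DD X Y X' Y' : D X Y + D X' Y' = D (X + X') (Y + Y').
  by apply: etrans (add_block_mx _ _ _ _ _ _ _ _) _; rewrite !addr0.
have DC c : c%:M = D c%:M c%:M by exact: scalar_mx_block.
elim/poly_ind: p => [|p c IHp].
  by rewrite !rmorph0; exact: (esym (@block_mx0 K m.+1 n.+1 m.+1 n.+1)).
by rewrite !(rmorphD, rmorphM) /= !(horner_mx_X, horner_mx_C) IHp DC DM DD.
Qed.

Lemma horner_mx_eigenvector n (A : 'M[K]_n.+1) (v : 'cV[K]_n.+1) c (p : {poly K}) :
  A *m v = c *: v -> horner_mx A p *m v = p.[c] *: v.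
Proof.
move=> Av; elim/poly_ind: p => [|p d IHp].
  by rewrite rmorph0 horner0 mul0mx scale0r.
rewrite rmorphD rmorphM /= horner_mx_X horner_mx_C hornerMXaddC.
rewrite mulmxDl -mulmxE -mulmxA Av -scalemxAr IHp mul_scalar_mx scalerA.
by rewrite scalerDl mulrC.
Qed.

End HornerMatrix.

(** * Rank under one-sided invertible factors *)

Section MatrixRank.

Variable K : fieldType.

Lemma mxrankMl_inv m n p (L : 'M[K]_(n, m)) (A : 'M[K]_(m, n)) (B : 'M[K]_(n, p)) :
  L *m A = 1%:M -> \rank (A *m B) = \rank B.
Proof. by move=> LA; apply/eqmx_rank/eqmxP/eqmxMfull/row_fullP; exists L. Qed.

Lemma mxrankMr_inv m n p (A : 'M[K]_(m, n)) (B : 'M[K]_(n, p)) (L : 'M[K]_(p, n)) :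
  B *m L = 1%:M -> \rank (A *m B) = \rank A.
Proof. by move=> BL; apply/mxrankMfree/row_freeP; exists L. Qed.

End MatrixRank.

(** * Chebyshev recurrence with arbitrary initial terms *)

Section Chebyshev.

Variable K : fieldType.
Variables p0 p1 : {poly K}.

(** The pair holds two consecutive terms, so that the second-order recurrence is structural.
    Starting from [2, 'X] it yields w^k + w^-k as a polynomial in w + w^-1; starting from [0, 1] it
    yields (w^k - w^-k) / (w - w^-1), that is U_(k-1), shifted by one index. *)
Fixpoint cheb k : {poly K} * {poly K} :=
  if k is k'.+1 then ((cheb k').2, 'X * (cheb k').2 - (cheb k').1) else (p0, p1).

Lemma horner_cheb x (g : nat -> K) k :
  g 0%N = p0.[x] -> g 1%N = p1.[x] ->
  (forall i, g i.+2 = x * g i.+1 - g i) ->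
  (cheb k).1.[x] = g k.
Proof.
move=> g0 g1 gS.
suff: (cheb k).1.[x] = g k /\ (cheb k).2.[x] = g k.+1 by case.
elim: k => [|k [IH1 IH2]]; first by rewrite g0 g1.
by split=> //=; rewrite !hornerE IH1 IH2 gS.
Qed.

(** Multiplication by ['X] raises the degree by one, and the subtracted term is too short to touch
    the leading coefficient. The offset [m] serves both families: 1 for [2, 'X] and 0 for [0, 1]. *)
Lemma size_monic_cheb m k :
  (size p0 <= m)%N -> size p1 = m.+1 -> p1 \is monic ->
  size (cheb k.+1).1 = (m + k).+1 /\ (cheb k.+1).1 \is monic.
Proof.
move=> s0 s1 mon1 /=.
suff: [/\ (size (cheb k).1 <= m + k)%N, size (cheb k).2 = (m + k).+1
        & (cheb k).2 \is monic] by case.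
elim: k => [|k [IH0 IH1 IHm]] /=; first by rewrite addn0.
have sX : size ('X * (cheb k).2) = (m + k).+2.
  by rewrite mulrC size_mulX ?monic_neq0 // IH1.
have lt_s : (size (- (cheb k).1)%R < size ('X * (cheb k).2)%R)%N.
  by rewrite size_polyN sX ltnS (leq_trans IH0).
split; first by rewrite IH1 addnS.
- by rewrite size_polyDl // sX addnS.
- by rewrite monicE lead_coefDl // -monicE monicMl // monicX.
Qed.

End Chebyshev.

(** * Values of classes modulo X^N - 1 at N-th roots of unity *)

Section CyclicQuotient.

Import Pdiv.CommonRing Pdiv.RingMonic.

Variables (K : fieldType) (N : nat).
Hypothesis N_gt0 : (0 < N)%N.

Local Notation cycK := {poly %/ ('X^N - 1 : {poly K})}.

(** [mk_monic] falls back on a default modulus unless its argument is monic and nonconstant; [N_gt0]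
    rules this out. *)
Lemma mk_monic_Xn_sub_1 : mk_monic ('X^N - 1 : {poly K}) = 'X^N - 1.
Proof. by rewrite /mk_monic size_Xn_sub_1 // monic_Xn_sub_1 // ltnS N_gt0. Qed.

Lemma horner_in_qpoly (p : {poly K}) z :
  z ^+ N = 1 -> (in_qpoly ('X^N - 1) p : {poly K}).[z] = p.[z].
Proof.
move=> zN.
have root_z : (mk_monic ('X^N - 1 : {poly K})).[z] = 0.
  by rewrite mk_monic_Xn_sub_1 !hornerE zN subrr.
rewrite [in RHS](rdivp_eq (monic_mk_monic ('X^N - 1)) p).
by rewrite hornerD hornerM root_z mulr0 add0r.
Qed.

Lemma horner_qpolyM (f g : cycK) z :
  z ^+ N = 1 -> (f * g : cycK).[z] = f.[z] * g.[z].
Proof. by move=> zN; rewrite -hornerM; exact: horner_in_qpoly. Qed.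

Lemma horner_qpoly_exp (f : cycK) z k :
  z ^+ N = 1 -> (f ^+ k : cycK).[z] = f.[z] ^+ k.
Proof.
move=> zN; elim: k => [|k IHk]; first by rewrite !expr0 /= hornerC.
by rewrite !exprS horner_qpolyM // IHk.
Qed.

Lemma qpolyX_unit : ('qX : cycK) \is a GRing.unit.
Proof.
apply/unitrPr; exists ('qX ^+ N.-1); rewrite -exprS prednK //.
rewrite -rmorphXn /= -[X in in_qpoly _ X](subrK 1) in_qpolyD in_qpoly1.
have -> : in_qpoly ('X^N - 1) ('X^N - 1) = 0 :> cycK.
  by apply/val_inj; rewrite /= mk_monic_Xn_sub_1 rmodpp // monic_Xn_sub_1.
by rewrite add0r.
Qed.

Lemma horner_qpolyXV z : z ^+ N = 1 -> (('qX : cycK)^-1 : cycK).[z] = z^-1.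
Proof.
move=> zN.
have z0 : z != 0 by apply: contra_eq_neq zN => ->; rewrite expr0n eqn0Ngt N_gt0 eq_sym oner_eq0.
have : ('qX * 'qX^-1 : cycK).[z] = 1 by rewrite mulrV ?qpolyX_unit //= hornerC.
by rewrite horner_qpolyM // horner_in_qpoly // hornerX => zV; apply: (mulfI z0); rewrite divff.
Qed.

End CyclicQuotient.

(** * Lagrange interpolation *)

Section Lagrange.

Variable K : fieldType.

Lemma lagrange_basis n (x : 'I_n -> K) : injective x -> forall i,
  exists2 p : {poly K}, size p = n & forall j, p.[x j] = (j == i)%:R.
Proof.
move=> x_inj i; pose q := \prod_(j | j != i) ('X - (x j)%:P).
have qi0 : q.[x i] != 0.
  rewrite horner_prod; apply/prodf_neq0 => j ne.
  by rewrite hornerXsubC subr_eq0 (inj_eq x_inj) eq_sym.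
exists (q.[x i]^-1 *: q).
  rewrite size_scale ?invr_eq0 // /q -big_filter size_prod_XsubC.
  rewrite size_filter -sum1_count sum1_card cardC1 card_ord prednK //.
  exact: leq_ltn_trans (ltn_ord i).
move=> j; rewrite hornerZ; case: eqP => [->|/eqP ne]; first by rewrite mulVf.
by rewrite [q.[x j]]horner_prod (bigD1 j) //= hornerXsubC subrr mul0r mulr0.
Qed.

End Lagrange.

(** * Primitivity of omega *)

Section Omega.

Variables (R : realType) (N : nat).
Hypothesis N_gt0 : (0 < N)%N.

Lemma omega_exp k : omega R N ^+ k =
  cos (pi *+ 2 / N%:R *+ k) +i* sin (pi *+ 2 / N%:R *+ k).
Proof.
elim: k => [|k IHk]; first by rewrite expr0 mulr0n cos0 sin0.
rewrite exprS IHk [_ *+ k.+1]mulrS cosD sinD /omega.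
by apply/eqP; rewrite eq_complex /= [X in _ && (_ == X)]addrC !eqxx.
Qed.

(** If omega^k = 1 with 0 < k < N, the half angle h = pi k / N satisfies cos 2h = 1, hence cos^2 h =
    1 and sin h = 0, although 0 < h < pi. *)
Lemma omega_prim : N.-primitive_root (omega R N).
Proof.
have N0 : N%:R != 0 :> R by rewrite pnatr_eq0 -lt0n.
apply/andP; split=> //; apply/forallP => k; apply/eqP.
rewrite unity_rootE omega_exp.
have [->|neqN] := eqVneq k.+1 N.
  by rewrite -[_ *+ N]mulr_natr divfK // cos2pi sin2pi eqxx.
have k_lt : (k.+1 < N)%N by rewrite ltn_neqAle neqN ltn_ord.
apply/eqP => /eqP; rewrite eq_complex /= => /andP[/eqP cos1 _].
pose h : R := pi * (k.+1%:R / N%:R).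
have hE : pi *+ 2 / N%:R *+ k.+1 = h *+ 2.
  by rewrite /h -mulr_natr -[pi *+ 2]mulr_natr -[RHS]mulr_natr; field.
have : 0 < sin h.
  apply: sin_gt0_pi; rewrite /h mulr_gt0 ?pi_gt0 ?divr_gt0 ?ltr0n //=.
  by rewrite gtr_pMr ?pi_gt0 // ltr_pdivrMr ?ltr0n // mul1r ltr_nat.
move: cos1; rewrite hE cos_mulr2n => cos1 sin_gt0.
have := cos2Dsin2 h; have -> : cos h ^+ 2 = 1.
  apply: (mulfI (_ : 2 != 0 :> R)); first by rewrite pnatr_eq0.
  by move/eqP: cos1; rewrite subr_eq mulr1 mulr_natl => /eqP.
move/eqP; rewrite eq_sym addrC -subr_eq subrr eq_sym sqrf_eq0.
by rewrite gt_eqF.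
Qed.

End Omega.

Lemma omega_half (R : realType) n : (0 < n)%N -> omega R (2 * n) ^+ n = -1.
Proof.
move=> n0; rewrite omega_exp.
have -> : pi *+ 2 / (2 * n)%:R *+ n = pi :> R.
  have n0' : n%:R != 0 :> R by rewrite pnatr_eq0 -lt0n.
  by rewrite natrM -mulr_natr -[pi *+ 2]mulr_natr; field.
by rewrite cospi sinpi; apply/eqP; rewrite eq_complex /= oppr0 !eqxx.
Qed.

(** * The operators t, d, a, s acting on sampled functions *)

Section Model.

Variables (R : realType) (n : nat) (u : R[i]).
Local Notation N := (2 * n)%N.
Hypothesis n_gt1 : (1 < n)%N.
Hypothesis u_neq0 : u != 0.
Hypothesis uN : u ^+ N != 1.

Local Notation om := (omega R N).

Let n_gt0 : (0 < n)%N := ltnW n_gt1.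
Let N_gt1 : (1 < N)%N. Proof. by case: (n) n_gt0 => // k _; rewrite mulnS. Qed.
Let om_prim : N.-primitive_root om. Proof. exact/omega_prim/ltnW. Qed.
Let om_primZ : (dimZ N).-primitive_root om. Proof. by rewrite Zp_cast. Qed.
Let omN : om ^+ N = 1 := prim_expr_order om_prim.
Let om_n : om ^+ n = -1 := omega_half R n_gt0.
Let om_neq0 : om != 0.
Proof.
by apply: contraTneq (oner_neq0 R[i]) => om0; rewrite -omN om0 expr0n eqn0Ngt ltnW ?eqxx.
Qed.
Let omX_neq0 k : om ^+ k != 0. Proof. exact: expf_neq0. Qed.

(** Vectors are given by formulas in z, so that t acts by substitution and s by division by a. *)
Definition grid (F : R[i] -> R[i]) : 'cV[R[i]]_(dimZ N) :=
  \col_(j < dimZ N) F (om ^+ j).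

Lemma eq_grid F G : (forall k, F (om ^+ k) = G (om ^+ k)) -> grid F = grid G.
Proof. by move=> FG; apply/matrixP => i j; rewrite !mxE. Qed.

Lemma t_op_grid F : t_op R N *m grid F = grid (fun z => F (om * z)).
Proof.
apply/matrixP => i j; rewrite !mxE (bigD1 (i + 1 : 'Z_N)) //= big1 => [|k ne].
  rewrite !mxE addrK eqxx mul1r addr0 /=; congr F.
  (* The index i + 1 is reduced modulo N, which powers of omega do not see. *)
  by rewrite -exprS modnDmr (prim_expr_mod om_primZ) addn1.
rewrite !mxE; case: eqP => [ik|_]; last by rewrite mul0r.
by rewrite ik subrK eqxx in ne.
Qed.

Lemma t_op_unit : t_op R N \in unitmx.
Proof.
suff /mulmx1_unit[] : t_op R N *m (\matrix_(i, j) (i == j + 1 :> 'Z_N)%:R) = 1%:M by [].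
apply/matrixP => i j; rewrite !mxE (bigD1 (i + 1 : 'Z_N)) //= big1 => [|k ne].
  by rewrite !mxE addrK eqxx mul1r addr0 (inj_eq (addIr _)).
rewrite !mxE; case: eqP => [ik|_]; last by rewrite mul0r.
by rewrite ik subrK eqxx in ne.
Qed.

(** The samples of F form an eigenvector of t for c, hence of t^-1 for c^-1. *)
Lemma t_op_antisym_grid (f : {poly R[i]}) F c :
  c != 0 -> (forall k, F (om ^+ k.+1) = c * F (om ^+ k)) ->
  (horner_mx (t_op R N) f - horner_mx (t_op R N)^-1 f) *m grid F =
  (f.[c] - f.[c^-1]) *: grid F.
Proof.
move=> c0 Fc.
have tF : t_op R N *m grid F = c *: grid F.
  rewrite t_op_grid; apply/matrixP => i j; rewrite !mxE -exprS; exact: Fc.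
have tVF : (t_op R N)^-1 *m grid F = c^-1 *: grid F.
  by rewrite -[in LHS](scalerK c0 (grid F)) -tF -scalemxAr (mulKmx t_op_unit).
by rewrite mulmxBl !(horner_mx_eigenvector f tF, horner_mx_eigenvector f tVF) scalerBl.
Qed.

(** Raising to the power n would give u^N = 1. This yields both the invertibility of a and the
    separation of the nodes. *)
Lemma sqr_u_omega_neq1 k : (u * om ^+ k) ^+ 2 != 1.
Proof.
apply: contraNneq uN => uo1.
have -> : u ^+ N = ((u * om ^+ k) ^+ 2) ^+ n.
  by rewrite -exprM exprMn [(om ^+ k) ^+ _]exprAC omN expr1n mulr1.
by rewrite uo1 expr1n.
Qed.

Lemma a_omega_neq0 k : u * om ^+ k - (u * om ^+ k)^-1 != 0.
Proof.
have w0 : u * om ^+ k != 0 by rewrite mulf_neq0.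
rewrite subr_eq0; apply: contraNneq (sqr_u_omega_neq1 k) => e.
by rewrite expr2 [X in X * _]e mulVf.
Qed.

Lemma a_opE : a_op N u =
  diag_mx (\row_(j < dimZ N) (u * om ^+ j - (u * om ^+ j)^-1)).
Proof.
have dV : (d_op R N)^-1 = diag_mx (\row_(j < dimZ N) om ^- j).
  have dM : d_op R N *m diag_mx (\row_(j < dimZ N) om ^- j) = 1%:M.
    apply/matrixP => i j; rewrite mulmx_diag !mxE.
    by rewrite mulfV.
  have [du _] := mulmx1_unit dM.
  by rewrite -[LHS]mulmx1 -dM mulKmx.
rewrite /a_op dV /d_op; apply/matrixP => i j; rewrite !mxE.
by case: eqP => _; rewrite /= ?mulr0n ?mulr1n ?mulr0 ?subrr // invfM.
Qed.

Lemma a_op_unit : a_op N u \in unitmx.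
Proof.
rewrite a_opE unitmxE det_diag unitfE; apply/prodf_neq0 => j _.
by rewrite mxE a_omega_neq0.
Qed.

Lemma s_op_unit : s_op N u \in unitmx.
Proof. by rewrite /s_op unitmx_inv a_op_unit. Qed.

Lemma s_op_grid F :
  s_op N u *m grid (fun z => (u * z - (u * z)^-1) * F z) = grid F.
Proof.
have <- : a_op N u *m grid F = grid (fun z => (u * z - (u * z)^-1) * F z).
  by rewrite a_opE; apply/matrixP => i j; rewrite mul_diag_mx !mxE.
exact/mulKmx/a_op_unit.
Qed.

(** * Action of B_f on C[x] and rho C[x] *)

(* [e] selects the summand: [false] for polynomials in x, [true] for rho times *)
(* polynomials in x; rho turns f(t) into f(-t).                                *)
Definition sgn_val (e : bool) (f : {poly R[i]}) k : R[i] :=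
  f.[(-1) ^+ e * om ^+ k] - f.[(-1) ^+ e * om ^- k].

Definition xgrid (e : bool) (p : {poly R[i]}) :=
  grid (fun z => z ^+ (n * e) * p.[u * z + (u * z)^-1]).

Lemma xgridD e p q : xgrid e (p + q) = xgrid e p + xgrid e q.
Proof. by apply/matrixP => i j; rewrite !mxE hornerD mulrDr. Qed.

Lemma xgridZ e c p : xgrid e (c *: p) = c *: xgrid e p.
Proof. by apply/matrixP => i j; rewrite !mxE hornerZ mulrCA. Qed.

Lemma xgrid0 e : xgrid e 0 = 0.
Proof. by apply/matrixP => i j; rewrite !mxE horner0 mulr0. Qed.

Lemma rho_omega (e : bool) k : (om ^+ k) ^+ (n * e) = ((-1) ^+ k) ^+ e.
Proof. by rewrite exprAC exprM om_n exprAC. Qed.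

(** The two monomials in the sum are eigenvectors of t with mutually inverse eigenvalues, so D_f
    multiplies them by opposite scalars and turns the sum into a difference; s then divides by a. *)
Lemma B_op_grid_cheb (e : bool) (f : cyc R N) k :
  B_op u f *m grid (fun z => z ^+ (n * e) * ((u * z) ^+ k + (u * z) ^- k)) =
  sgn_val e f k *: grid (fun z => z ^+ (n * e) *
     (((u * z) ^+ k - (u * z) ^- k) / (u * z - (u * z)^-1))).
Proof.
set Fp := fun z : R[i] => z ^+ (n * e) * (u * z) ^+ k.
set Fm := fun z : R[i] => z ^+ (n * e) * (u * z) ^- k.
have sg0 : (-1) ^+ e != 0 :> R[i] by rewrite signr_eq0.
have -> : grid (fun z => z ^+ (n * e) * ((u * z) ^+ k + (u * z) ^- k)) = grid Fp + grid Fm.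
  by apply/matrixP => i j; rewrite !mxE mulrDr.
rewrite mulmxDr /B_op -!mulmxA.
rewrite (@t_op_antisym_grid f Fp ((-1) ^+ e * om ^+ k)) ?mulf_neq0 //; last first.
  move=> l; rewrite /Fp !rho_omega exprS exprMn !exprS.
  rewrite ![(u * _) ^+ k]exprMn [(_ * om ^+ l) ^+ k]exprMn; ring.
rewrite (@t_op_antisym_grid f Fm ((-1) ^+ e * om ^- k)) ?mulf_neq0 ?invr_neq0 //; last first.
  move=> l; rewrite /Fm !rho_omega exprS exprMn !exprS.
  rewrite ![(u * _) ^+ k]exprMn [(_ * om ^+ l) ^+ k]exprMn !invfM; ring.
have -> : f.[(-1) ^+ e * om ^- k] - f.[((-1) ^+ e * om ^- k)^-1] = - sgn_val e f k.
  by rewrite /sgn_val opprB invr_signM invrK.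
rewrite {1}invr_signM -/(sgn_val e f k) -mulmxDr scaleNr -scalerBr -scalemxAr.
congr (_ *: _); rewrite -[RHS]s_op_grid; congr (_ *m _).
apply/matrixP => i j; rewrite !mxE.
by have := a_omega_neq0 i; set a := _ - _ => a0; rewrite /Fp /Fm mulrCA [a * _]mulrC divfK // mulrBr.
Qed.

Local Notation chebT k := (cheb (2%:P : {poly R[i]}) 'X k).1.
Local Notation chebU k := (cheb (0 : {poly R[i]}) 1 k).1.

Lemma B_op_xgrid_cheb (e : bool) (f : cyc R N) k :
  B_op u f *m xgrid e (chebT k) = sgn_val e f k *: xgrid e (chebU k).
Proof.
have w0 l : u * om ^+ l != 0 by rewrite mulf_neq0.
have -> : xgrid e (chebT k) =
    grid (fun z => z ^+ (n * e) * ((u * z) ^+ k + (u * z) ^- k)).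
  apply: eq_grid => l; congr (_ * _); have := w0 l; set w := u * _ => w_neq0.
  apply: (@horner_cheb _ _ _ _ (fun i => w ^+ i + w ^- i)).
  - by rewrite hornerC expr0 invr1.
  - by rewrite hornerX expr1.
  - by move=> i; rewrite !exprS; field; rewrite w_neq0 expf_neq0.
rewrite B_op_grid_cheb; congr (_ *: _).
apply: eq_grid => l; congr (_ * _).
have := a_omega_neq0 l; have := w0 l; set w := u * _ => w_neq0 a0; apply/esym.
apply: (@horner_cheb _ _ _ _ (fun i => (w ^+ i - w ^- i) / (w - w^-1))).
- by rewrite horner0 expr0 invr1 subrr mul0r.
- by rewrite hornerC expr1 divff.
- move=> i; rewrite mulrA -mulrBl; congr (_ / _).
  by rewrite !exprS; field; rewrite w_neq0 expf_neq0.
Qed.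

(** Induction on the degree bound, removing the top term with a multiple of [chebT]. Since [chebT m]
    and [chebU m] are monic for positive m, the top coefficient is just multiplied by
    [sgn_val e f m]. *)
Lemma B_op_xgrid (e : bool) (f : cyc R N) m (p : {poly R[i]}) :
  (size p <= m.+1)%N ->
  exists2 q : {poly R[i]}, (size q <= m)%N & B_op u f *m xgrid e p = xgrid e q /\
                               q`_m.-1 = sgn_val e f m * p`_m.
Proof.
elim: m p => [|m IHm] p sp.
  (* Constants are killed; the coefficient claim at [0.-1 = 0] then reads 0 = 0. *)
  have sgn0 : sgn_val e f 0 = 0 by rewrite /sgn_val expr0 invr1 subrr.
  exists 0; first by rewrite size_poly0.
  split; last by rewrite coef0 sgn0 mul0r.
  (* [chebT 0] is the constant 2. *)
  have -> : p = (p`_0 / 2) *: chebT 0.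
    by rewrite [LHS]size1_polyC //= -mul_polyC -polyCM divfK // pnatr_eq0.
  by rewrite xgridZ -scalemxAr B_op_xgrid_cheb sgn0 scale0r scaler0 xgrid0.
have [|||sT monT] := @size_monic_cheb _ (2%:P : {poly R[i]}) 'X 1 m.
- exact: size_polyC_leq1.
- exact: size_polyX.
- exact: monicX.
have [|||sU monU] := @size_monic_cheb _ (0 : {poly R[i]}) 1 0 m.
- by rewrite size_poly0.
- exact: size_poly1.
- exact: monic1.
set c := p`_m.+1.
have lead (q : {poly R[i]}) k : size q = k.+1 -> q \is monic -> q`_k = 1.
  by move=> sq /monicP; rewrite /lead_coef sq.
have [|q sq [Bq q_m]] := IHm (p - c *: chebT m.+1).
  apply/leq_sizeP => j; rewrite leq_eqVlt => /predU1P[<-|lt_j].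
    by rewrite coefB coefZ (lead _ _ sT monT) mulr1 subrr.
  rewrite coefB coefZ [p`_j]nth_default ?(leq_trans sp) //.
  by rewrite [_`_j]nth_default ?mulr0 ?subrr // sT.
exists (q + (c * sgn_val e f m.+1) *: chebU m.+1).
  rewrite (leq_trans (size_polyD _ _)) // geq_max (leq_trans sq) //.
  by rewrite (leq_trans (size_scale_leq _ _)) // sU.
split.
  rewrite xgridD xgridZ -scalerA -B_op_xgrid_cheb scalemxAr -xgridZ -Bq -mulmxDr.
  by rewrite -xgridD subrK.
by rewrite coefD coefZ (lead _ _ sU monU) nth_default // add0r mulr1 mulrC.
Qed.

Definition sgn_prod (e : bool) M (f : 'I_M -> cyc R N) : R[i] :=
  \prod_(j < M) sgn_val e (f j) j.+1.

(** The rightmost factor acts first, on degree at most M, and each factor lowers the bound by one.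
    Thus f_j meets the bound j, whence the power omega^j in its contribution to the constant. *)
Lemma B_prod_xgrid (e : bool) M (f : 'I_M -> cyc R N) (p : {poly R[i]}) :
  (size p <= M.+1)%N ->
  (\prod_(j < M) B_op u (f j)) *m xgrid e p = (sgn_prod e f * p`_M) *: xgrid e 1.
Proof.
elim: M f p => [|M IHM] f p sp.
  rewrite /sgn_prod !big_ord0 mul1mx mul1r -xgridZ; congr (xgrid _ _).
  by rewrite [LHS]size1_polyC // -mul_polyC mulr1.
rewrite /sgn_prod !big_ord_recr /= -mulmxE -mulmxA.
have [q sq [-> q_M]] := B_op_xgrid e (f ord_max) sp.
by rewrite IHM // q_M mulrA.
Qed.


(** * Decomposition of C^N by interpolation at nodes of fixed parity *)

Local Notation xnode k := (u * om ^+ k + (u * om ^+ k)^-1).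

(** The difference of two nodes factors as (w - v)(1 - (w v)^-1). Equal parity of the exponents
    makes w v the square of some u omega^k, which is never 1. *)
Lemma xnode_inj (b : bool) : injective (fun i : 'I_n => xnode (b + i.*2)).
Proof.
move=> i j; have w0 k : u * om ^+ k != 0 by rewrite mulf_neq0.
set w := u * _; set v := u * _ => e.
have /eqP : (w - v) * (1 - (w * v)^-1) = 0.
  have -> : (w - v) * (1 - (w * v)^-1) = (w + w^-1) - (v + v^-1).
    by field; rewrite !w0.
  by rewrite e subrr.
have wv : w * v = (u * om ^+ (b + i + j)) ^+ 2.
  rewrite /w /v mulrACA -exprD -expr2 exprMn -exprM; congr (_ * om ^+ _).
  by rewrite -!addnn; lia.
rewrite mulf_eq0 subr_eq0 => /orP[|]; last first.
  rewrite subr_eq0 eq_sym invr_eq1 wv => /eqP wv1.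
  by case/eqP: (sqr_u_omega_neq1 (b + i + j)).
rewrite (inj_eq (mulfI u_neq0)) (eq_prim_root_expr om_prim).
have ltN (k : 'I_n) : (b + k.*2 < N)%N by have := ltn_ord k; lia.
rewrite !modn_small // => /eqP eij.
by apply/val_inj => /=; lia.
Qed.

(** With h the Lagrange polynomial of node k among the nodes of its parity, take h/2 and (-1)^k h/2.
    As rho equals (-1)^l at index l, the sum is h (1 + (-1)^(l+k))/2, which erases the opposite
    parity. *)
Lemma delta_xgrid (k : 'I_(dimZ N)) : exists p q : {poly R[i]},
  [/\ (size p <= n)%N, (size q <= n)%N
    & delta_mx k 0 = xgrid false p + xgrid true q].
Proof.
have k_lt : (k < N)%N by have := ltn_ord k; rewrite [X in (_ < X)%N]Zp_cast.
have k2_lt : (k./2 < n)%N by lia.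
have [h sh hE] := lagrange_basis (@xnode_inj (odd k)) (Ordinal k2_lt).
exists (2^-1 *: h), ((-1) ^+ k / 2 *: h); split.
- by rewrite (leq_trans (size_scale_leq _ _)) // sh.
- by rewrite (leq_trans (size_scale_leq _ _)) // sh.
apply/matrixP => l j; rewrite !mxE !hornerZ !rho_omega ord1 eqxx andbT.
have l_lt : (l < N)%N by have := ltn_ord l; rewrite [X in (_ < X)%N]Zp_cast.
rewrite expr0 expr1 mul1r mulrA mulrA -exprD.
have l2_lt : (l./2 < n)%N by lia.
set H := h.[_].
have -> : 2^-1 * H + (-1) ^+ (l + k) / 2 * H = (odd l == odd k)%:R * H.
  by rewrite -signr_odd oddD; case: (odd l); case: (odd k) => /=; field.
case: (odd l =P odd k) => odd_lk; last first.
  by rewrite mul0r; case: (l =P k) odd_lk => // ->.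
have := hE (Ordinal l2_lt); rewrite /= -odd_lk odd_double_half mul1r -/H => ->.
congr (_%:R); apply: congr1; apply/eqP/eqP => [/(congr1 val) /= e|/(congr1 val) /= e].
  by apply/val_inj; rewrite /= e.
by apply/val_inj; rewrite /= -(odd_double_half l) -(odd_double_half k) odd_lk e.
Qed.

(** * Vanishing and rank of products of B_f *)

Lemma B_prod_eq0 M (f : 'I_M -> cyc R N) :
  (n <= M)%N -> \prod_(j < M) B_op u (f j) = 0.
Proof.
move=> le_nM; apply/trmx_inj/row_matrixP => k.
rewrite -tr_col colE trmx0 row0.
have [p [q [sp sq ->]]] := delta_xgrid k.
rewrite mulmxDr !B_prod_xgrid; try exact: leq_trans (leq_trans _ le_nM) (leqnSn M).
(* Both polynomials have size at most n, so their coefficients of index M >= n vanish. *)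
by rewrite !nth_default ?mulr0 ?scale0r ?addr0 ?trmx0 // (leq_trans _ le_nM).
Qed.

(** At indices 0 and 1 the vector 1 takes the values 1, 1 and rho the values 1, -1; the half sum and
    half difference of these coordinates are dual to them. *)
Lemma row_xgrid1_linv : exists L : 'M[R[i]]_(1 + 1, dimZ N),
  L *m row_mx (xgrid false 1) (xgrid true 1) = 1%:M.
Proof.
pose r0 := 2^-1 *: (delta_mx 0 0 + delta_mx 0 1) : 'rV[R[i]]_(dimZ N).
pose r1 := 2^-1 *: (delta_mx 0 0 - delta_mx 0 1) : 'rV[R[i]]_(dimZ N).
exists (col_mx r0 r1); rewrite mul_col_row scalar_mx_block.
have dE (e : bool) (k : 'I_(dimZ N)) :
    delta_mx 0 k *m xgrid e 1 = (((-1) ^+ k) ^+ e)%:M :> 'M[R[i]]_1.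
  rewrite -rowE; apply/matrixP => i j.
  by rewrite !ord1 !mxE hornerC mulr1 rho_omega eqxx mulr1n.
rewrite /r0 /r1 -!scalemxAl !mulmxDl !mulNmx !dE !expr1 !expr0 /=.
by congr block_mx; apply/matrixP => i j; rewrite !ord1 !mxE /= !mulr1n; field.
Qed.

(** The product has the same column space as [E *m D], where [E] has the independent columns 1 and
    rho and [D] is the diagonal of the two constants. *)
Lemma rank_B_prod (f : 'I_n.-1 -> cyc R N) :
  \rank (\prod_(j < n.-1) B_op u (f j)) =
  ((sgn_prod false f != 0)%R + (sgn_prod true f != 0)%R)%N.
Proof.
set P := \prod_(j < _) _.
pose E := row_mx (xgrid false 1) (xgrid true 1).
pose D := block_mx (sgn_prod false f)%:M 0 0 (sgn_prod true f)%:M : 'M[R[i]]_(1 + 1).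
have PE (p q : {poly R[i]}) : (size p <= n)%N -> (size q <= n)%N ->
    P *m row_mx (xgrid false p) (xgrid true q) =
    row_mx ((sgn_prod false f * p`_n.-1) *: xgrid false 1)
           ((sgn_prod true f * q`_n.-1) *: xgrid true 1).
  by move=> sp sq; rewrite mul_mx_row !B_prod_xgrid // prednK.
have rankD : \rank D = ((sgn_prod false f != 0)%R + (sgn_prod true f != 0)%R)%N.
  rewrite rank_diag_block_mx !rank_rV.
  have scal1 (c : R[i]) : (c%:M != 0 :> 'M[R[i]]_1) = (c != 0).
    by congr negb; apply/eqP/eqP => [/matrixP/(_ 0 0)|->]; rewrite ?raddf0 // !mxE mulr1n.
  by rewrite !scal1.
have ED : E *m D = row_mx (sgn_prod false f *: xgrid false 1) (sgn_prod true f *: xgrid true 1).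
  by rewrite mul_row_block !mulmx0 addr0 add0r !mul_mx_scalar.
have [L LE] := row_xgrid1_linv.
rewrite -rankD -(mxrankMl_inv D LE) -/E; apply/eqP; rewrite eqn_leq; apply/andP; split.
  (* Transposition turns the inclusion of column spaces into one of row spaces, checked on basis
     vectors. *)
  rewrite -mxrank_tr -[X in (_ <= X)%N]mxrank_tr; apply/mxrankS/row_subP => k.
  have [p [q [sp sq kE]]] := delta_xgrid k.
  rewrite -tr_col colE kE mulmxDr !B_prod_xgrid ?prednK //.
  apply/submxP; exists (col_mx (p`_n.-1)%:M (q`_n.-1)%:M)^T.
  by rewrite -trmx_mul ED mul_row_col !mul_mx_scalar !scalerA ![_`_ _ * _]mulrC.
(* For the converse, x^(n-1) and rho x^(n-1) have top coefficient 1, so their images are exactly the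
   columns of [E *m D]. *)
have sX : (size ('X^(n.-1) : {poly R[i]})%R <= n)%N by rewrite size_polyXn prednK.
have := PE _ _ sX sX; rewrite !coefXn eqxx !mulr1 ED => <-.
exact: mxrankM_maxl.
Qed.

(** * Reduction of words to products of B_f *)

Lemma row_horner_T_op_col (f : {poly R[i]}) :
  row_mx 1%:M 1%:M *m (horner_mx (T_op R N) f : 'M[R[i]]_(dimZ N + dimZ N))
    *m col_mx 1%:M (- 1%:M) =
  horner_mx (t_op R N) f - horner_mx (t_op R N)^-1 f.
Proof.
have -> : horner_mx (T_op R N) f =
    block_mx (horner_mx (t_op R N) f) 0 0 (horner_mx (t_op R N)^-1 f)
    :> 'M[R[i]]_(dimZ N + dimZ N)
  by exact (@horner_mx_block_diag (R[i]) _ (Zp_trunc N).+1 (t_op R N) _ f).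
rewrite mul_row_block mul_row_col.
by rewrite !mulmx0 addr0 add0r !mul1mx mulmx1 mulmxN mulmx1.
Qed.

Lemma LambdaE : Lambda N u = col_mx 1%:M (- 1%:M) *m s_op N u *m row_mx 1%:M 1%:M.
Proof.
by rewrite mul_col_mx mul_col_row !mul1mx mulNmx mul1mx !mulmx1.
Qed.

Lemma word0 (f : 'I_0 -> cyc R N) : word f u = Lambda N u.
Proof. by rewrite /word big_ord0; exact: mulr1. Qed.

Lemma word_recr M (f : 'I_M.+1 -> cyc R N) :
  word f u = word (fun i => f (widen_ord (leqnSn M) i)) u
             *m (horner_mx (T_op R N) (f ord_max) : 'M[R[i]]_(dimZ N + dimZ N))
             *m Lambda N u.
Proof. by rewrite /word big_ord_recr; exact: (etrans (mulrA _ _ _) (mulrA _ _ _)). Qed.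

(** Between consecutive copies of s, the inner row, f(T) and column collapse to D_f. Each D_f joins
    the s on its left to form B_f, leaving one s at the end. *)
Lemma wordE M (f : 'I_M -> cyc R N) :
  word f u = col_mx 1%:M (- 1%:M) *m (\prod_(j < M) B_op u (f j) *m s_op N u)
             *m row_mx 1%:M 1%:M.
Proof.
elim: M f => [|M IHM] f.
  by rewrite word0 big_ord0 mul1mx LambdaE.
rewrite word_recr IHM {1}LambdaE big_ord_recr /= /B_op -row_horner_T_op_col.
by rewrite -!mulmxE !mulmxA.
Qed.

(** The outer column has a left inverse, the outer row a right inverse, and the trailing s is
    invertible. *)
Lemma rank_word M (f : 'I_M -> cyc R N) :
  \rank (word f u) = \rank (\prod_(j < M) B_op u (f j)).
Proof.
rewrite wordE.
rewrite (@mxrankMr_inv _ _ _ _ _ _ (col_mx 1%:M 0)); last first.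
  by rewrite mul_row_col mulmx0 addr0 mulmx1.
rewrite (@mxrankMl_inv _ _ _ _ (row_mx 1%:M 0)); last first.
  by rewrite mul_row_col mul0mx addr0 mulmx1.
by apply: mxrankMfree; rewrite row_free_unit s_op_unit.
Qed.


(** * Vectors coming from the quotient ring *)

Let N_gt0 : (0 < N)%N := ltnW N_gt1.
Let omX_N k : (om ^+ k) ^+ N = 1. Proof. by rewrite exprAC omN expr1n. Qed.

Lemma horner_zR k : (zR R N : {poly _}).[om ^+ k] = om ^+ k.
Proof. by rewrite horner_in_qpoly ?hornerX. Qed.

Lemma horner_zRV k : ((zR R N)^-1 : {poly _}).[om ^+ k] = om ^- k.
Proof. by rewrite horner_qpolyXV. Qed.

Lemma horner_aR k : (aR N u : {poly _}).[om ^+ k] = u * om ^+ k - (u * om ^+ k)^-1.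
Proof.
have -> : aR N u = u *: (zR R N : {poly _}) - u^-1 *: ((zR R N)^-1 : {poly _}) :> {poly _} by [].
by rewrite hornerD hornerN !hornerZ horner_zR horner_zRV invfM.
Qed.

Lemma horner_xR k : (xR N u : {poly _}).[om ^+ k] = xnode k.
Proof.
have -> : xR N u = u *: (zR R N : {poly _}) + u^-1 *: ((zR R N)^-1 : {poly _}) :> {poly _} by [].
by rewrite hornerD !hornerZ horner_zR horner_zRV invfM.
Qed.

Lemma horner_rhoR k : (rhoR R N n : {poly _}).[om ^+ k] = (om ^+ k) ^+ n.
Proof. by rewrite horner_qpoly_exp ?horner_zR. Qed.

Lemma evalRE (g : cyc R N) : evalR g = grid (fun z => (g : {poly _}).[z]).
Proof. by []. Qed.

Lemma s_op_evalR (g : cyc R N) : s_op N u *m evalR (aR N u * g) = evalR g.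
Proof.
rewrite (evalRE g) -s_op_grid; congr (_ *m _); apply: eq_grid => k.
by rewrite horner_qpolyM ?horner_aR //.
Qed.

Lemma evalR_xR k : evalR (xR N u ^+ k) = xgrid false 'X^k.
Proof.
apply: eq_grid => l; rewrite muln0 expr0 mul1r hornerXn.
by rewrite horner_qpoly_exp ?horner_xR //.
Qed.

Lemma evalR_rho_xR k : evalR (rhoR R N n * xR N u ^+ k) = xgrid true 'X^k.
Proof.
apply: eq_grid => l; rewrite muln1 hornerXn.
by rewrite horner_qpolyM ?horner_rhoR ?horner_qpoly_exp ?horner_xR //.
Qed.

Lemma evalR_1 : evalR (1 : cyc R N) = xgrid false 1.
Proof. by rewrite -[1 in LHS](expr0 (xR N u)) evalR_xR expr0. Qed.

Lemma evalR_rho : evalR (rhoR R N n) = xgrid true 1.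
Proof. by rewrite -[rhoR _ _ _]mulr1 -(expr0 (xR N u)) evalR_rho_xR expr0. Qed.

(** Here s cancels a, leaving x^(n-1) or rho x^(n-1), whose top coefficient is 1. *)
Lemma B_prod_evalR (f : 'I_n.-1 -> cyc R N) :
  \prod_(j < n.-1) B_op u (f j) *m s_op N u *m evalR (aR N u * xR N u ^+ n.-1)
    = sgn_prod false f *: evalR 1
  /\
  \prod_(j < n.-1) B_op u (f j) *m s_op N u
      *m evalR (aR N u * rhoR R N n * xR N u ^+ n.-1)
    = sgn_prod true f *: evalR (rhoR R N n).
Proof.
rewrite -!mulmxA -mulrA !s_op_evalR evalR_xR evalR_rho_xR evalR_1 evalR_rho.
by rewrite !B_prod_xgrid ?size_polyXn // coefXn eqxx !mulr1.
Qed.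

Lemma CplusE M (f : 'I_M -> cyc R N) : Cplus f = sgn_prod false f.
Proof. by apply: eq_bigr => j _; rewrite /sgn_val expr0 !mul1r. Qed.

Lemma CminusE M (f : 'I_M -> cyc R N) : Cminus f = sgn_prod true f.
Proof. by apply: eq_bigr => j _; rewrite /sgn_val expr1 !mulN1r. Qed.

(** * A word of rank one *)

Lemma omega_subV_neq0 k : (0 < k < n)%N -> om ^+ k - om ^- k != 0.
Proof.
move=> /andP[k_gt0 k_lt]; rewrite subr_eq0; apply/eqP => e.
have /eqP : om ^+ (k + k) = om ^+ 0 by rewrite exprD {2}e mulfV.
have kk_lt : (k + k < N)%N by rewrite addnn -mul2n ltn_pmul2l.
by rewrite (eq_prim_root_expr om_prim) mod0n modn_small // addnn double_eq0 gtn_eqF.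
Qed.

(* The coefficient of z in f_1 is chosen so that f_1(-omega) = f_1(-1/omega).  *)
Definition rank1_fun (j : 'I_n.-1) : cyc R N :=
  if j == 0%N :> nat then in_qpoly ('X^N - 1) ((om + om^-1) *: 'X + 'X^2)
  else zR R N.

(** C^- vanishes through its first factor, f_1 being -1 at both -omega and -1/omega. In C^+ the
    first factor is 2 (omega^2 - omega^-2), nonzero because 2 < n, and the others are omega^k -
    omega^-k with 0 < k < n. *)
Lemma sgn_prod_rank1_fun : (2 < n)%N ->
  sgn_prod false rank1_fun != 0 /\ sgn_prod true rank1_fun = 0.
Proof.
move=> n_gt2.
have n1 : (0 < n.-1)%N by rewrite ltn_predRL.
have omV_N k : (om ^- k) ^+ N = 1 by rewrite exprVn omX_N invr1.
have omV1_N : om^-1 ^+ N = 1 by rewrite -[om]expr1.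
(* N is even, so the negatives of N-th roots of unity are again such roots and classes may be
   evaluated there. *)
have oppN (z : R[i]) : (- z) ^+ N = z ^+ N by rewrite exprM sqrrN -exprM.
split; last first.
  apply/eqP/prodf_eq0; exists (Ordinal n1) => //.
  rewrite /sgn_val /rank1_fun /= !horner_in_qpoly ?expr1 ?mulN1r ?oppN ?omX_N ?omV_N ?omN ?omV1_N //.
  by rewrite !hornerE; apply/eqP; field.
rewrite /sgn_prod; apply/prodf_neq0 => j _; rewrite /sgn_val /rank1_fun !expr0 !mul1r.
case: (nat_of_ord j =P 0%N) => [->|j0]; last first.
  rewrite !horner_in_qpoly ?omX_N ?omV_N ?omN ?omV1_N //.
  by rewrite !hornerX omega_subV_neq0 //= -ltn_predRL ltn_ord.
rewrite !horner_in_qpoly ?omX_N ?omV_N ?omN ?omV1_N //.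
rewrite !hornerE.
have -> : (om + om^-1) * om + om ^+ 2 - ((om + om^-1) * om^-1 + om^-1 ^+ 2)
   = 2 * (om ^+ 2 - om ^- 2) by field.
by rewrite mulf_neq0 ?pnatr_eq0 ?omega_subV_neq0.
Qed.

(** * Words in powers of the ideal J *)

Lemma algA_horner (p : {poly R[i]}) : horner_mx (T_op R N) p \in algA N u.
Proof.
have A1 : 1 \in algA N u by rewrite memvE sub1_agenv.
have AT : T_op R N \in algA N u.
  by apply: (subvP (sub_agenv _)); apply: memv_span; rewrite mem_head.
elim/poly_ind: p => [|p c IHp]; first by rewrite rmorph0 mem0v.
rewrite rmorphD rmorphM /= horner_mx_X horner_mx_C memvD //.
  by rewrite /algA -agenvM memv_mul.
by rewrite -scalemx1 memvZ.
Qed.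

Lemma idealJ_horner (p : {poly R[i]}) :
  horner_mx (T_op R N) p * Lambda N u \in idealJ N u.
Proof.
rewrite -[X in X \in _]mulr1 memv_mul ?memvE ?sub1_agenv //.
by rewrite -memvE memv_mul ?algA_horner ?memv_line.
Qed.

(** A word splits into M + 1 blocks f(T) [Lambda], each in J, the first one with f = 1. *)
Lemma word_idealJ M (f : 'I_M -> cyc R N) : word f u \in (idealJ N u ^+ M.+1)%VS.
Proof.
elim: M f => [|M IHM] f.
  by rewrite word0 expv1; have := idealJ_horner 1; rewrite rmorph1 mul1r.
by rewrite word_recr -mulmxA expvSr memv_mul ?IHM ?idealJ_horner.
Qed.

End Model.

(** * Vanishing, rank formula, explicit vectors and rank one operators *)

Theorem theorem5p3 (R : realType) (n N : nat) (u : R[i]) :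
  N = (2 * n)%N -> (4 <= N)%N -> u != 0 -> u ^+ N != 1 ->
  (* (1) *)
  (forall (M : nat) (f : 'I_M -> cyc R N), (n <= M)%N -> word f u = 0)
  /\
  (* (2) *)
  (forall f : 'I_n.-1 -> cyc R N,
     \rank (word f u) = (((Cplus f != 0)%R : nat) + ((Cminus f != 0)%R : nat))%N
     /\ (word f u = 0 <-> Cplus f = 0 /\ Cminus f = 0))
  /\
  (* (3) *)
  (forall f : 'I_n.-1 -> cyc R N,
     (\prod_(j < n.-1) B_op u (f j)) *m s_op N u
        *m evalR (aR N u * xR N u ^+ n.-1)
       = Cplus f *: evalR 1
     /\
     (\prod_(j < n.-1) B_op u (f j)) *m s_op N u
        *m evalR (aR N u * rhoR R N n * xR N u ^+ n.-1)
       = Cminus f *: evalR (rhoR R N n))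
  /\
  (* (4) *)
  ((6 <= N)%N ->
     (exists f : 'I_n.-1 -> cyc R N, \rank (word f u) = 1%N)
     /\ (exists2 X : 'M[R[i]]_(dimZ N + dimZ N), X \in (idealJ N u ^+ n)%VS & \rank X = 1%N)).
Proof.
move=> -> N_ge4 u0 uN; have n_gt1 : (1 < n)%N by lia.
have rankE (f : 'I_n.-1 -> cyc R (2 * n)) :
    \rank (word f u) = (((Cplus f != 0)%R : nat) + ((Cminus f != 0)%R : nat))%N.
  by rewrite rank_word // rank_B_prod // CplusE CminusE.
split; [|split; [|split]].
- by move=> M f le_nM; rewrite wordE // B_prod_eq0 // !(mul0mx, mulmx0).
- move=> f; split=> //; split=> [w0|[Cp Cm]]; last first.
    by apply/eqP; rewrite -mxrank_eq0 rankE Cp Cm eqxx.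
  have := rankE f; rewrite w0 mxrank0.
  by case: (Cplus f =P 0) => // ->; case: (Cminus f =P 0).
- by move=> f; rewrite CplusE CminusE; apply: B_prod_evalR.
- move=> N_ge6; have n_gt2 : (2 < n)%N by lia.
  have [Cp Cm] := sgn_prod_rank1_fun R n_gt1 n_gt2.
  have rank1 : \rank (word (@rank1_fun R n) u) = 1%N.
    by rewrite rankE CplusE CminusE Cp Cm eqxx.
  split; first by exists (@rank1_fun R n).
  exists (word (@rank1_fun R n) u) => //.
  by have := word_idealJ u (@rank1_fun R n); rewrite prednK // ltnW.
Qed.
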